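(* Let $\overline\rho,\overline\theta,\overline p_\rho,\overline p_\theta,\overline e_\theta,\overline k,\overline\nu,\overline\lambda,\overline\alpha>0$ be constants and $\overline u\in\mathbb{R}^3$. The linearized Navier--Stokes--Fourier--Korteweg system for $U=(\rho,u,\theta)^\top\in\mathbb{R}^5$, $u\in\mathbb{R}^3$, $x\in\mathbb{R}^3$, $$\rho_t+\overline u\cdot\nabla\rho+\overline\rho\,\nabla\cdot u=0,$$ $$\overline\rho\,u_t+\overline\rho\,(\overline u\cdot\nabla)u+\overline p_\rho\nabla\rho+\overline p_\theta\nabla\theta=\overline\nu\Delta u+(\overline\nu+\overline\lambda)\nabla(\nabla\cdot u)+\overline k\,\overline\rho\,\nabla\Delta\rho,$$ $$\overline\rho\,\overline e_\theta\theta_t+\overline\rho\,\overline e_\theta\,\overline u\cdot\nabla\theta+\overline\theta\,\overline p_\theta\nabla\cdot u=\overline\alpha\Delta\theta,$$ is symbol symmetrizable and genuinely coupled.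
   Context: The system is the linearization around a constant state $(\overline\rho,\overline u,\overline\theta)$ of the heat conducting, viscous, capillary compressible fluid equations; overlined quantities are values at that state of the derivatives of pressure $p$ and internal energy $e$, capillarity $k$, viscosities $\nu,\lambda$ and heat conductivity $\alpha$. After division by the constants multiplying the time derivatives the system has the form $U_t+\sum_{|\alpha|\le m}L^\alpha D^\alpha U=0$ with constant real $n\times n$ matrices. For $\xi\in\mathbb{R}^d\setminus\{0\}$, $\omega=\xi/|\xi|$, put $A(\xi)=\sum_{|\alpha|\text{ odd}}|\xi|^{|\alpha|-1}(-1)^{(|\alpha|-1)/2}\omega^\alpha L^\alpha$ and $B(\xi)=\sum_{|\alpha|\text{ even}}|\xi|^{|\alpha|}(-1)^{|\alpha|/2}\omega^\alpha L^\alpha$ (so $\widehat U_t+i|\xi|A\widehat U+B\widehat U=0$). Symbol symmetrizable: there is $S\in C^\infty(\mathbb{R}^d\setminus\{0\};\mathbb{R}^{n\times n})$ with $S(\xi)$ symmetric positive definite, $S(\xi)A(\xi)$ and $S(\xi)B(\xi)$ symmetric and $S(\xi)B(\xi)\ge0$ for all $\xi\neq0$. Genuinely coupled: for every $\xi\ne0$, $(\mu I_n+A(\xi))\psi\ne0$ for every $\mu\in\mathbb{R}$ and every $\psi\in\ker B(\xi)$, $\psi\ne0$. *)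

(* Defs.v *)
From mathcomp Require Import all_boot all_order all_algebra.
From mathcomp Require Import all_classical all_reals all_analysis.

Set Implicit Arguments.
Unset Strict Implicit.
Unset Printing Implicit Defensive.

Import Order.TTheory GRing.Theory Num.Theory.
Import numFieldNormedType.Exports.

Local Open Scope classical_set_scope.
Local Open Scope ring_scope.

Section Calculus.
Context {R : realType} {d : nat}.
Implicit Types (f : 'rV[R]_d -> R) (v : 'rV[R]_d -> 'rV[R]_d).

Definition partial (i : 'I_d) f : 'rV[R]_d -> R :=
  fun x => 'D_(delta_mx 0 i) f x.

Definition grad f : 'rV[R]_d -> 'rV[R]_d := fun x => \row_i partial i f x.

Definition divergence v : 'rV[R]_d -> R :=
  fun x => \sum_i partial i (fun y => v y 0 i) x.

Definition laplacian f : 'rV[R]_d -> R :=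
  fun x => \sum_i partial i (partial i f) x.

Definition vlaplacian v : 'rV[R]_d -> 'rV[R]_d :=
  fun x => \row_i laplacian (fun y => v y 0 i) x.

(* a . grad f, resp. (a . grad) v, for a constant vector a *)
Definition advect (a : 'rV[R]_d) f : 'rV[R]_d -> R :=
  fun x => \sum_j a 0 j * partial j f x.

Definition vadvect (a : 'rV[R]_d) v : 'rV[R]_d -> 'rV[R]_d :=
  fun x => \row_i advect a (fun y => v y 0 i) x.

(* f is C^k on O, meant for open O: f and its iterated partial derivatives of
   order <= k exist and are continuous at the points of O.  The values of f
   outside O play no role. *)
Fixpoint Ck_on (O : set 'rV[R]_d) (k : nat) f : Prop :=
  (forall x, O x -> {for x, continuous f}) /\
  match k with
  | 0 => True
  | k'.+1 => forall i : 'I_d,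
      (forall x, O x -> derivable f x (delta_mx 0 i)) /\
      Ck_on O k' (partial i f)
  end.

Definition smooth_on (O : set 'rV[R]_d) f : Prop := forall k, Ck_on O k f.

(* Euclidean norm; the library's `|x| on 'rV[R]_d is the sup norm. *)
Definition enorm (x : 'rV[R]_d) : R := Num.sqrt (\sum_i x 0 i ^+ 2).

Definition direction (x : 'rV[R]_d) : 'rV[R]_d := (enorm x)^-1 *: x.

End Calculus.

(* Multi-indices in N^d with entries <= m; those of length <= m are exactly
   the multi-indices of length <= m in N^d. *)
Notation multiindex d m := {ffun 'I_d -> 'I_m.+1}.

Definition milen (d m : nat) (a : multiindex d m) : nat :=
  (\sum_(i < d) (a i : nat))%N.

Definition mipow (R : realType) (d m : nat) (x : 'rV[R]_d)
    (a : multiindex d m) : R :=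
  \prod_(i < d) x 0 i ^+ a i.

Definition miderive (R : realType) (d m : nat) (a : multiindex d m)
    (f : 'rV[R]_d -> R) : 'rV[R]_d -> R :=
  foldr (fun i g => iter (a i) (partial i) g) f (enum 'I_d).

Section Systems.
Context {R : realType} {d n m : nat}.

Definition regular_field (U : R -> 'rV[R]_d -> 'cV[R]_n) : Prop :=
  forall i : 'I_n,
    (forall t x, derivable (fun s => U s x i 0) t 1) /\
    (forall t, smooth_on setT (fun x => U t x i 0)).

Definition time_derive (U : R -> 'rV[R]_d -> 'cV[R]_n)
    (t : R) (x : 'rV[R]_d) : 'cV[R]_n :=
  \col_i derive1 (fun s => U s x i 0) t.

Definition space_derive (a : multiindex d m) (U : R -> 'rV[R]_d -> 'cV[R]_n)
    (t : R) (x : 'rV[R]_d) : 'cV[R]_n :=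
  \col_i miderive a (fun y => U t y i 0) x.

(* The system P, given as a pointwise condition on U, takes the form
   U_t + \sum_(|a| <= m) L^a D^a U = 0.  Since the derivatives of U at a point
   can be prescribed arbitrarily, P determines L^a for all |a| <= m. *)
Definition normal_form
    (P : (R -> 'rV[R]_d -> 'cV[R]_n) -> R -> 'rV[R]_d -> Prop)
    (L : multiindex d m -> 'M[R]_n) : Prop :=
  forall U, regular_field U -> forall t x,
    P U t x <->
    time_derive U t x
      + \sum_(a : multiindex d m | (milen a <= m)%N)
          L a *m space_derive a U t x = 0.

Variable L : multiindex d m -> 'M[R]_n.

Definition symbolA (xi : 'rV[R]_d) : 'M[R]_n :=
  \sum_(a : multiindex d m | (milen a <= m)%N && odd (milen a))
     (enorm xi ^+ (milen a).-1 * (-1) ^+ ((milen a).-1)./2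
        * mipow (direction xi) a) *: L a.

Definition symbolB (xi : 'rV[R]_d) : 'M[R]_n :=
  \sum_(a : multiindex d m | (milen a <= m)%N && ~~ odd (milen a))
     (enorm xi ^+ milen a * (-1) ^+ (milen a)./2
        * mipow (direction xi) a) *: L a.

Definition symmetric_mx (M : 'M[R]_n) : Prop := M^T = M.

Definition posdef_mx (M : 'M[R]_n) : Prop :=
  forall v : 'cV[R]_n, v != 0 -> 0 < (v^T *m M *m v) 0 0.

Definition possemidef_mx (M : 'M[R]_n) : Prop :=
  forall v : 'cV[R]_n, 0 <= (v^T *m M *m v) 0 0.

Definition symbol_symmetrizable : Prop :=
  exists S : 'rV[R]_d -> 'M[R]_n,
    (forall i j, smooth_on [set xi | xi != 0] (fun xi => S xi i j)) /\
    (forall xi, xi != 0 ->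
       [/\ symmetric_mx (S xi) /\ posdef_mx (S xi),
           symmetric_mx (S xi *m symbolA xi),
           symmetric_mx (S xi *m symbolB xi)
         & possemidef_mx (S xi *m symbolB xi)]).

Definition genuinely_coupled : Prop :=
  forall xi : 'rV[R]_d, xi != 0 ->
  forall (mu : R) (psi : 'cV[R]_n),
    symbolB xi *m psi = 0 -> psi != 0 ->
    (mu%:M + symbolA xi) *m psi != 0.

End Systems.

(* Positions of rho, u_1, u_2, u_3, theta in U = (rho, u, theta). *)
Definition i_rho : 'I_(1 + (3 + 1)) := lshift (3 + 1) ord0.
Definition i_u (j : 'I_3) : 'I_(1 + (3 + 1)) := rshift 1 (lshift 1 j).
Definition i_theta : 'I_(1 + (3 + 1)) := rshift 1 (rshift 3 ord0).

(* The parameters are the values at the constant state (rhob, ub, thetab) of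
   p_rho, p_theta, e_theta, k, nu, lambda and the heat conductivity alpha. *)
Definition nsfk_system (R : realType) (rhob : R) (ub : 'rV[R]_3)
    (thetab prho ptheta etheta k nu lambda alpha : R)
    (U : R -> 'rV[R]_3 -> 'cV[R]_5) (t : R) (x : 'rV[R]_3) : Prop :=
  let rho (s : R) (y : 'rV[R]_3) : R := U s y i_rho 0 in
  let u (s : R) (y : 'rV[R]_3) : 'rV[R]_3 := \row_j U s y (i_u j) 0 in
  let theta (s : R) (y : 'rV[R]_3) : R := U s y i_theta 0 in
  let rho_t := derive1 (rho ^~ x) t in
  let u_t : 'rV[R]_3 := \row_j derive1 (fun s => u s x 0 j) t in
  let theta_t := derive1 (theta ^~ x) t in
  [/\ rho_t + advect ub (rho t) x + rhob * divergence (u t) x = 0,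
      rhob *: u_t + rhob *: vadvect ub (u t) x
        + prho *: grad (rho t) x + ptheta *: grad (theta t) x
      = nu *: vlaplacian (u t) x
        + (nu + lambda) *: grad (divergence (u t)) x
        + (k * rhob) *: grad (laplacian (rho t)) x
    & rhob * etheta * theta_t + rhob * etheta * advect ub (theta t) x
        + thetab * ptheta * divergence (u t) x
      = alpha * laplacian (theta t) x].

(* Main.v *)
(* With w = xi / |xi| and q = |xi|, on V = (rho, u, theta)
     A V = (ub.w) V + (rhob (w.u),
                       (prho / rhob + k q^2) rho w + (ptheta / rhob) theta w,
                       thetab ptheta / (rhob etheta) (w.u)),
     B V = q^2 (0, (nu / rhob) u + ((nu + lambda) / rhob) (w.u) w,
                alpha / (rhob etheta) theta).
   The diagonal matrix S = diag((prho / rhob + k q^2) / rhob, 1, etheta / thetab)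
   balances the off-diagonal entries of A and commutes with the block structure
   of B; it is polynomial in xi.  The form of S B dominates q^2 (|u|^2 + theta^2)
   up to a constant, so ker B is the line u = 0, theta = 0, on which A has the
   nonzero velocity component (prho / rhob + k q^2) rho w.  Reading the system as
   a normal form indexed by multi-indices requires the symmetry of iterated
   partial derivatives of smooth functions. *)
Require Import Defs.
From mathcomp Require Import all_boot all_order all_algebra.
From mathcomp Require Import all_classical all_reals all_analysis.
From mathcomp Require Import ring lra.

Set Implicit Arguments.
Unset Strict Implicit.
Unset Printing Implicit Defensive.

Import Order.TTheory GRing.Theory Num.Theory.
Import numFieldNormedType.Exports.

Local Open Scope classical_set_scope.
Local Open Scope ring_scope.

(** * Symmetry of second derivatives *)

Section Schwarz.
Context {R : realType} {V : normedModType R}.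
Implicit Types (f : V -> R) (x v w : V).

Lemma is_derive_line f x v (s : R) : derivable f (x + s *: v) v ->
  is_derive s 1 (fun r => f (x + r *: v)) ('D_v f (x + s *: v)).
Proof.
have E : (fun h : R => h^-1 *:
     (((fun r => f (x + r *: v)) \o shift s) (h *: 1) - f (x + s *: v))) =
   (fun h => h^-1 *: ((f \o shift (x + s *: v)) (h *: v) - f (x + s *: v))).
  apply/funext => h /=; rewrite -[X in X + s]/(h * 1) mulr1 scalerDl.
  by rewrite addrCA.
move=> df; split; first by rewrite /derivable E.
by rewrite /derive E.
Qed.

Lemma MVT_line f x v (h : R) : 0 < h -> (forall y, derivable f y v) ->
  exists2 s : R, 0 <= s <= h & f (x + h *: v) - f x = 'D_v f (x + s *: v) * h.
Proof.
move=> h0 df.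
have [|||s] := @MVT R (fun r => f (x + r *: v))
    (fun r => 'D_v f (x + r *: v)) 0 h.
- exact: h0.
- by move=> s _; apply: is_derive_line.
- apply: derivable_within_continuous => s _.
  exact: (@ex_derive _ _ _ _ _ _ _ (is_derive_line (df _))).
rewrite in_itv /= => /andP[s0 sh]; rewrite scale0r addr0 subr0 => ->.
by exists s => //; rewrite !ltW.
Qed.

(** The mean value theorem is applied twice: along [v] to the increment
    [g y = f (y + h *: w) - f y], whose derivative is an increment of ['D_v f], and then along [w]
    to ['D_v f] itself. *)
Lemma second_difference f x v w (h : R) : 0 < h ->
  (forall y, derivable f y v) -> (forall y, derivable ('D_v f) y w) ->
  exists s t : R, [/\ 0 <= s <= h, 0 <= t <= h &
    f (x + h *: v + h *: w) - f (x + h *: v) - f (x + h *: w) + f x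
    = 'D_w ('D_v f) (x + s *: v + t *: w) * h * h].
Proof.
move=> h0 df ddf.
pose g y := f (y + h *: w) - f y.
have dsh y : is_derive y v (fun z => f (z + h *: w)) ('D_v f (y + h *: w)).
  have E : (fun r : R => r^-1 *:
      (((fun z => f (z + h *: w)) \o shift y) (r *: v) - f (y + h *: w))) =
     (fun r => r^-1 *:
      ((f \o shift (y + h *: w)) (r *: v) - f (y + h *: w))).
    by apply/funext => r /=; rewrite addrA.
  by split; [rewrite /derivable E; exact: df|rewrite /derive E].
have dg y : is_derive y v g ('D_v f (y + h *: w) - 'D_v f y).
  have dfy := derivableP (df y).
  exact: (@is_deriveB _ _ _ (fun z => f (z + h *: w)) f).
have [s sh Es] := MVT_line x h0 (fun y => @ex_derive _ _ _ _ _ _ _ (dg y)).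
have [t th Et] := MVT_line (x + s *: v) h0 ddf.
exists s, t; split => //.
rewrite -Et -(@derive_val _ _ _ _ _ _ _ (dg _)) -Es /g.
by rewrite addrAC [RHS]addrAC; ring.
Qed.

(** The second difference of [f] at [x] does not change when [v] and [w] are exchanged. Hence the
    two mixed derivatives take a common value, each at its own intermediate point near [x], and
    continuity at [x] puts both within [e / 2] of that value. *)
Lemma derive_comm f x v w :
  (forall y, derivable f y v) -> (forall y, derivable f y w) ->
  (forall y, derivable ('D_v f) y w) -> (forall y, derivable ('D_w f) y v) ->
  {for x, continuous ('D_w ('D_v f))} -> {for x, continuous ('D_v ('D_w f))} ->
  'D_w ('D_v f) x = 'D_v ('D_w f) x.
Proof.
move=> dv dw dvw dwv cvw cwv; apply/eqP; rewrite -subr_eq0 -normr_le0.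
apply/ler_addgt0Pl => e e0; rewrite addr0.
have e20 : 0 < e / 2 by rewrite divr_gt0.
have /nbhs_ballP[d /= d0 Hd] :
    \forall y \near x, `|'D_w ('D_v f) x - 'D_w ('D_v f) y| < e / 2 /\
                       `|'D_v ('D_w f) x - 'D_v ('D_w f) y| < e / 2.
  by apply: filterI; [move/cvgrPdist_lt: cvw|move/cvgrPdist_lt: cwv]; apply.
(* The summand 1 keeps [c] positive when [v] and [w] both vanish. With [h = d / 2 / c], every point
   [x + s *: v + t *: w] with [s] and [t] in [[0, h]] lies in the ball of radius [d], since
   [h * c = d / 2]. *)
pose c := `|v| + `|w| + 1.
have c0 : 0 < c by rewrite ltr_wpDl // addr_ge0.
pose h := d / 2 / c.
have h0 : 0 < h by rewrite !divr_gt0.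
have near_x a b s t : a + b = `|v| + `|w| :> R -> 0 <= s <= h -> 0 <= t <= h ->
    0 <= a -> 0 <= b -> s * a + t * b < d.
  move=> ab /andP[s0 sh] /andP[t0 th] a0 b0.
  apply: (@le_lt_trans _ _ (h * (a + b))).
    by rewrite mulrDr lerD // ler_wpM2r.
  rewrite ab; apply: (@lt_trans _ _ (h * c)).
    by rewrite ltr_pM2l // /c ltrDl.
  by rewrite /h divfK ?gt_eqF //; lra.
have nrm x1 x2 s t : 0 <= s <= h -> 0 <= t <= h ->
    `|s *: x1 + t *: x2| <= s * `|x1| + t * `|x2|.
  move=> /andP[s0 _] /andP[t0 _]; apply: le_trans (ler_normD _ _) _.
  by rewrite !normrZ !ger0_norm.
have [s [t [sh th E1]]] := second_difference x h0 dv dvw.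
have [s' [t' [sh' th' E2]]] := second_difference x h0 dw dwv.
have E : 'D_w ('D_v f) (x + s *: v + t *: w)
       = 'D_v ('D_w f) (x + s' *: w + t' *: v).
  apply: (mulIf (lt0r_neq0 h0)); apply: (mulIf (lt0r_neq0 h0)).
  apply: (etrans (esym E1)); apply: etrans E2.
  rewrite (addrAC x (h *: w)).
  by apply: (congr1 (fun r => r + f x)); exact: addrAC.
have [B1 _] : `|'D_w ('D_v f) x - 'D_w ('D_v f) (x + s *: v + t *: w)| < e / 2 /\
              `|'D_v ('D_w f) x - 'D_v ('D_w f) (x + s *: v + t *: w)| < e / 2.
  apply: Hd; rewrite -ball_normE /= -addrA opprD addNKr normrN.
  by apply: le_lt_trans (nrm _ _ _ _ sh th) _; apply: near_x.
have [_ B2] :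
    `|'D_w ('D_v f) x - 'D_w ('D_v f) (x + s' *: w + t' *: v)| < e / 2 /\
    `|'D_v ('D_w f) x - 'D_v ('D_w f) (x + s' *: w + t' *: v)| < e / 2.
  apply: Hd; rewrite -ball_normE /= -addrA opprD addNKr normrN.
  apply: le_lt_trans (nrm _ _ _ _ sh' th') _.
  exact: near_x (addrC _ _) sh' th' (normr_ge0 _) (normr_ge0 _).
apply: le_trans (ler_distD ('D_w ('D_v f) (x + s *: v + t *: w)) _ _) _.
rewrite [leRHS]splitr; apply: lerD; first exact: ltW B1.
by rewrite E distrC; exact: ltW B2.
Qed.

End Schwarz.

(** * Smooth functions and multi-indices *)

Section Smooth.
Context {R : realType} {d : nat}.
Implicit Types (f g : 'rV[R]_d -> R) (i j : 'I_d) (s : seq 'I_d).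

Lemma Ck_on_sub (O O' : set 'rV[R]_d) k f :
  O `<=` O' -> Ck_on O' k f -> Ck_on O k f.
Proof.
move=> OO'; elim: k f => [|k IH] f /= [cf]; first by split=> // x /OO'/cf.
move=> df; split=> [x /OO'/cf//|i]; have [dfi ci] := df i.
by split=> [x /OO'/dfi//|]; apply: IH.
Qed.

Lemma Ck_cst k (a : R) : Ck_on setT k (fun _ : 'rV[R]_d => a).
Proof.
elim: k a => [|k IH] a /=; (split; first by move=> x _; exact: cst_continuous) => //.
move=> i; split; first by move=> x _; exact: derivable_cst.
rewrite (_ : partial i _ = fun=> 0) //.
by apply/funext => x; rewrite /partial derive_cst.
Qed.

Lemma CkD k f g : Ck_on setT k f -> Ck_on setT k g -> Ck_on setT k (f \+ g).
Proof.
elim: k f g => [|k IH] f g /= [cf df] [cg dg].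
  by split=> // x _; exact: (continuousD (cf x I) (cg x I)).
split=> [x _|i]; first by exact: (continuousD (cf x I) (cg x I)).
have [dfi cfi] := df i; have [dgi cgi] := dg i.
split=> [x _|]; first exact: (derivableD (dfi x I) (dgi x I)).
rewrite (_ : partial i _ = partial i f \+ partial i g); first exact: IH.
by apply/funext => x; rewrite /partial (deriveD (dfi x I) (dgi x I)).
Qed.

Lemma CkW k f : Ck_on setT k.+1 f -> Ck_on setT k f.
Proof.
elim: k f => [|k IH] f; first by move=> [cf _]; split.
move=> [cf df]; split=> // i; have [dfi cfi] := df i.
by split=> //; apply: IH.
Qed.

Lemma CkM k f g :
  Ck_on setT k f -> Ck_on setT k g -> Ck_on setT k (fun x => f x * g x).
Proof.
elim: k f g => [|k IH] f g.
  move=> /= [cf _] [cg _].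
  by split=> // x _; exact: (continuousM (cf x I) (cg x I)).
move=> Cf Cg; have [cf df] := Cf; have [cg dg] := Cg.
split=> [x _|i]; first by exact: (continuousM (cf x I) (cg x I)).
have [dfi cfi] := df i; have [dgi cgi] := dg i.
split=> [x _|]; first exact: (derivableM (dfi x I) (dgi x I)).
rewrite (_ : partial i _ =
    (fun x => f x * partial i g x) \+ (fun x => g x * partial i f x)).
  (* The Leibniz rule brings back the undifferentiated factors, which are then needed at the lower
     order [k]. *)
  by apply: CkD; apply: IH => //; exact: CkW.
by apply/funext => x; rewrite /partial (deriveM (dfi x I) (dgi x I)).
Qed.

Lemma is_derive_coord j (x v : 'rV[R]_d) :
  is_derive x v (fun y : 'rV[R]_d => y 0 j) (v 0 j).
Proof.
have E : (fun h : R => h^-1 *: (((fun y : 'rV[R]_d => y 0 j) \o shift x) (h *: v)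
           - x 0 j)) @ 0^' --> v 0 j.
  apply: cvg_near_cst; near=> h.
  rewrite /= !mxE addrK /GRing.scale /= mulrA mulVf ?mul1r //.
  by near: h; exact: nbhs_dnbhs_neq.
by split; [apply/cvg_ex; exists (v 0 j)|exact: cvg_lim E].
Unshelve. all: by end_near. Qed.

Lemma Ck_coord k j : Ck_on setT k (fun x : 'rV[R]_d => x 0 j).
Proof.
case: k => [|k] /=; (split; first by move=> x _; exact: coord_continuous) => //.
move=> i; split=> [x _|].
  exact: (@ex_derive _ _ _ _ _ _ _ (is_derive_coord j x _)).
rewrite (_ : partial i _ = fun=> (delta_mx 0 i : 'rV[R]_d) 0 j).
  exact: Ck_cst.
apply/funext => x.
exact: (@derive_val _ _ _ _ _ _ _ (is_derive_coord j x _)).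
Qed.

Lemma Ck_sum k n (F : 'I_n -> 'rV[R]_d -> R) :
  (forall l, Ck_on setT k (F l)) -> Ck_on setT k (fun x => \sum_l F l x).
Proof.
elim: n F => [|n IH] F CF.
  by rewrite (_ : (fun _ => _) = fun=> 0); [exact: Ck_cst|
     apply/funext => x; rewrite big_ord0].
rewrite (_ : (fun _ => _) = F ord0 \+ (fun x => \sum_l F (lift ord0 l) x)).
  by apply: CkD => //; apply: IH.
by apply/funext => x; rewrite big_ord_recl.
Qed.

Definition smooth f := smooth_on setT f.

Lemma smooth_derivable f i x : smooth f -> derivable f x (delta_mx 0 i).
Proof. by move=> /(_ 1%N)[_ /(_ i)[+ _]]; exact. Qed.

Lemma smooth_continuous f x : smooth f -> {for x, continuous f}.
Proof. by move=> /(_ 0%N)[+ _]; exact. Qed.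

Lemma smooth_partial f i : smooth f -> smooth (partial i f).
Proof. by move=> sf k; have [_ /(_ i)[]] := sf k.+1. Qed.

Lemma partial_comm f i j : smooth f ->
  partial i (partial j f) = partial j (partial i f).
Proof.
move=> sf; have sp l := smooth_partial l sf.
apply/funext => x; apply: (@derive_comm _ _ f x).
- by move=> y; exact: smooth_derivable.
- by move=> y; exact: smooth_derivable.
- by move=> y; apply: smooth_derivable; exact: sp.
- by move=> y; apply: smooth_derivable; exact: sp.
- by apply: smooth_continuous; do 2 apply: smooth_partial.
- by apply: smooth_continuous; do 2 apply: smooth_partial.
Qed.

Lemma partial_sum n (F : 'I_n -> 'rV[R]_d -> R) i : (forall l, smooth (F l)) ->
  partial i (fun x => \sum_l F l x) = fun x => \sum_l partial i (F l) x.
Proof.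
move=> sF; apply/funext => x; rewrite /partial.
rewrite (_ : (fun x => \sum_l F l x) = \sum_l F l); last first.
  by apply/funext => y; rewrite fct_sumE.
by apply: derive_sum => l; exact: smooth_derivable.
Qed.

(** * Multi-indices from lists of coordinates *)

(** A list of coordinates records an iterated derivative in the order in which it is written; this
    map forgets the order. A count above [m] would fall to the default value of [inord], hence the
    bound [size s <= m] in the lemmas below. *)
Definition mindex m s : multiindex d m := [ffun i => inord (count_mem i s)].

Lemma mindexE m s i : (size s <= m)%N -> mindex m s i = count_mem i s :> nat.
Proof.
by move=> sm; rewrite ffunE inordK // ltnS (leq_trans (count_size _ _)).
Qed.

Lemma sum_count_mem s : (\sum_(i < d) count_mem i s = size s)%N.
Proof.
elim: s => [|j s IH] /=; first by rewrite big1.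
rewrite big_split /= IH (bigD1 j) //= eqxx big1 // => i /negbTE.
by rewrite eq_sym => ->.
Qed.

Lemma milen_mindex m s : (size s <= m)%N -> milen (mindex m s) = size s.
Proof.
move=> sm; rewrite -sum_count_mem; apply: eq_bigr => i _; exact: mindexE.
Qed.

Lemma mipow_mindex m (x : 'rV[R]_d) s : (size s <= m)%N ->
  mipow x (mindex m s) = \prod_(i <- s) x 0 i.
Proof.
move=> sm; rewrite /mipow.
transitivity (\prod_i x 0 i ^+ count_mem i s).
  by apply: eq_bigr => i _; rewrite mindexE.
elim: s {sm} => [|j s IH] /=; first by rewrite big_nil big1.
rewrite big_cons -IH.
under eq_bigr do rewrite exprD.
rewrite big_split /= (bigD1 j) //= eqxx expr1 big1 ?mulr1 //.
by move=> i /negbTE; rewrite eq_sym => ->.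
Qed.

Definition partials s f := foldr (@partial R d) f s.

Lemma smooth_iter i k f : smooth f -> smooth (iter k (partial i) f).
Proof. by move=> sf; elim: k => //= k; exact: smooth_partial. Qed.

Lemma iter_partial_comm i j k f : smooth f ->
  iter k (partial i) (partial j f) = partial j (iter k (partial i) f).
Proof.
move=> sf; elim: k => //= k ->; rewrite partial_comm //; exact: smooth_iter.
Qed.

(** This is where the symmetry of partial derivatives enters: [miderive] differentiates in the order
    of the coordinates, [partials] in the order of the list. By induction on the list, each new
    letter is moved to the front. *)
Lemma miderive_mindex m s f : (size s <= m)%N -> smooth f ->
  miderive (mindex m s) f = partials s f.
Proof.
move=> sm sf; pose D (c : 'I_d -> nat) (e : seq 'I_d) :=
  foldr (fun i g => iter (c i) (partial i) g) f e.
have -> : miderive (mindex m s) f = D (fun i => count_mem i s) (enum 'I_d).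
  by rewrite /miderive /D; elim: (enum _) => //= i e ->; rewrite mindexE.
have sD c e : smooth (D c e) by elim: e => //= i e; exact: smooth_iter.
(* One more occurrence of [j] inserts a factor [partial j] at the place of [j] in [e], and
   commutation brings it outside. Uniqueness of [e] ensures that it is inserted only once. *)
have step j t e : uniq e ->
    D (fun i => count_mem i (j :: t)) e =
    (if j \in e then partial j else id) (D (fun i => count_mem i t) e).
  elim: e => //= i e IH /andP[ie /IH ->]; rewrite inE iterD.
  have [->|ji] /= := eqVneq j i; first by rewrite (negbTE ie).
  case: ifP => //= _; rewrite iter_partial_comm //; exact: sD.
elim: s {sm} => [|j s IH] /=; first by rewrite /D; elim: (enum _).
by rewrite step ?enum_uniq // mem_enum IH.
Qed.

End Smooth.

(** * Differential operators as lists of terms *)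

Section DifferentialTerms.
Context {R : realType} {d n m : nat}.
Implicit Type T : seq (seq 'I_d * 'M[R]_n).

(* The pair (s, M) stands for the differential term M D_(i_1) ... D_(i_k), where
   s = [:: i_1, ..., i_k]; terms with the same multi-index are added up. *)
Definition coeffs T : multiindex d m -> 'M[R]_n :=
  fun a => \sum_(p <- T | a == mindex m p.1) p.2.

(** Additivity of [c a] splits each coefficient into its terms; after exchanging the sums, a term
    meets exactly one multi-index. With suitable [c] this covers the differential operator and both
    symbols, so that later computations run over the list [T] instead of all multi-indices. *)
Lemma sum_coeffs (W : nmodType) (P : pred (multiindex d m))
    (c : multiindex d m -> 'M[R]_n -> W) T :
  (forall a, c a 0 = 0) -> (forall a, {morph c a : M N / M + N}) ->
  \sum_(a | P a) c a (coeffs T a) =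
  \sum_(p <- T | P (mindex m p.1)) c (mindex m p.1) p.2.
Proof.
move=> c0 cD.
under eq_bigr => a _ do rewrite (big_morph (c a) (cD a) (c0 a)).
rewrite (exchange_big_dep (fun p : seq 'I_d * 'M[R]_n => P (mindex m p.1))) /=.
  by apply: eq_bigr => p Pp; rewrite (big_pred1 (mindex m p.1)) // => a /=;
    case: eqP => [->|]; rewrite ?andbF ?andbT.
by move=> a p Pa /eqP <-.
Qed.

Variable T : seq (seq 'I_d * 'M[R]_n).
Hypothesis Tm : {in T, forall p, size p.1 <= m}%N.

Lemma sum_coeffs_derive (U : R -> 'rV[R]_d -> 'cV[R]_n) t x :
  regular_field U ->
  \sum_(a : multiindex d m | (milen a <= m)%N)
    coeffs T a *m space_derive a U t x =
  \sum_(p <- T) p.2 *m \col_i partials p.1 (fun y => U t y i 0) x.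
Proof.
move=> rU; rewrite (@sum_coeffs _ _ (fun a M => M *m space_derive a U t x)).
- rewrite big_seq_cond [RHS]big_seq; apply: eq_big => [p|p /andP[pT _]].
    by case pT: (p \in T); rewrite //= milen_mindex (Tm pT).
  apply: (congr1 (mulmx _)); apply/colP => i; rewrite !mxE miderive_mindex ?Tm //.
  by have [_] := rU i; apply.
- by move=> a; rewrite mul0mx.
- by move=> a M N; rewrite mulmxDl.
Qed.

Lemma symbolA_coeffs (xi : 'rV[R]_d) :
  symbolA (coeffs T) xi = \sum_(p <- T | odd (size p.1))
    (enorm xi ^+ (size p.1).-1 * (-1) ^+ (size p.1).-1./2
       * \prod_(i <- p.1) direction xi 0 i) *: p.2.
Proof.
rewrite /symbolA (@sum_coeffs _ _ (fun a M => (enorm xi ^+ (milen a).-1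
  * (-1) ^+ ((milen a).-1)./2 * mipow (direction xi) a) *: M)).
- rewrite big_seq_cond [RHS]big_seq_cond.
  apply: eq_big => [p|p /andP[pT _]]; last by rewrite milen_mindex ?mipow_mindex ?Tm.
  by case pT: (p \in T); rewrite //= milen_mindex (Tm pT).
- by move=> a; rewrite scaler0.
- by move=> a M N; rewrite scalerDr.
Qed.

Lemma symbolB_coeffs (xi : 'rV[R]_d) :
  symbolB (coeffs T) xi = \sum_(p <- T | ~~ odd (size p.1))
    (enorm xi ^+ size p.1 * (-1) ^+ (size p.1)./2
       * \prod_(i <- p.1) direction xi 0 i) *: p.2.
Proof.
rewrite /symbolB (@sum_coeffs _ _ (fun a M => (enorm xi ^+ milen a
  * (-1) ^+ (milen a)./2 * mipow (direction xi) a) *: M)).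
- rewrite big_seq_cond [RHS]big_seq_cond.
  apply: eq_big => [p|p /andP[pT _]]; last by rewrite milen_mindex ?mipow_mindex ?Tm.
  by case pT: (p \in T); rewrite //= milen_mindex (Tm pT).
- by move=> a; rewrite scaler0.
- by move=> a M N; rewrite scalerDr.
Qed.

End DifferentialTerms.

(** * Unit directions, bilinear forms and matrix units *)

Lemma enorm_gt0 (R : realType) d (x : 'rV[R]_d) : x != 0 -> 0 < enorm x.
Proof.
move=> x0; rewrite sqrtr_gt0 lt_def sumr_ge0 ?andbT => [|i _]; last exact: sqr_ge0.
apply: contraNneq x0 => /eqP.
rewrite psumr_eq0 => [/allP x0|i _]; last exact: sqr_ge0.
apply/eqP/rowP => i; rewrite mxE; apply/eqP; rewrite -sqrf_eq0.
exact: x0 (mem_index_enum i).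
Qed.

Lemma enorm_sqr (R : realType) d (x : 'rV[R]_d) :
  enorm x ^+ 2 = \sum_i x 0 i ^+ 2.
Proof. by rewrite sqr_sqrtr // sumr_ge0 // => i _; exact: sqr_ge0. Qed.

Lemma sum_direction_sqr (R : realType) d (x : 'rV[R]_d) :
  x != 0 -> \sum_i direction x 0 i ^+ 2 = 1.
Proof.
move=> x0; under eq_bigr do rewrite mxE exprMn.
rewrite -mulr_sumr -enorm_sqr -exprMn mulVf ?expr1n //.
by rewrite gt_eqF // enorm_gt0.
Qed.

(** Testing on basis vectors recovers the entries. Symmetry can thus be read off a closed formula
    for the bilinear form, without writing out the matrix. *)
Lemma bilinear_symmetric (R : realType) n (M : 'M[R]_n) :
  (forall v w : 'cV[R]_n, (w^T *m M *m v) 0 0 = (v^T *m M *m w) 0 0) ->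
  symmetric_mx M.
Proof.
move=> sM; pose e i : 'cV[R]_n := delta_mx i 0.
have E i j : M i j = ((e i)^T *m M *m e j) 0 0.
  by rewrite trmx_delta -rowE -colE !mxE.
by apply/matrixP => i j; rewrite mxE E sM -E.
Qed.

Lemma mul_diag_form (R : realType) n (e : 'rV[R]_n) (M : 'M[R]_n) (v w : 'cV[R]_n) :
  (w^T *m (diag_mx e *m M) *m v) 0 0 = \sum_i w i 0 * e 0 i * (M *m v) i 0.
Proof.
rewrite -!mulmxA mxE; apply: eq_bigr => i _.
by rewrite mxE mul_diag_mx [in LHS]mxE mulrA.
Qed.

Lemma delta_mul (R : realType) n (i j l : 'I_n) (v : 'cV[R]_n) :
  (delta_mx i j *m v) l 0 = (l == i)%:R * v j 0.
Proof.
rewrite mxE (bigD1 j) //= big1 ?addr0 => [|h /negbTE hj]; rewrite mxE.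
  by rewrite eqxx andbT.
by rewrite hj andbF mul0r.
Qed.

(** * The linearized Navier-Stokes-Fourier-Korteweg system *)

Lemma sum_components (W : nmodType) (F : 'I_5 -> W) :
  \sum_i F i = F i_rho + (\sum_j F (i_u j) + F i_theta).
Proof.
by rewrite [LHS](@big_split_ord _ _ _ 1 (3 + 1)) big_ord1 big_split_ord big_ord1.
Qed.

Lemma component_ind (P : 'I_5 -> Prop) :
  P i_rho -> (forall j, P (i_u j)) -> P i_theta -> forall i, P i.
Proof.
move=> Pr Pu Pt i; case: (@split_ordP 1 (3 + 1) i) => [j|j] ->.
  by rewrite (ord1 j).
by case: (split_ordP j) => l ->; [exact: Pu|rewrite (ord1 l)].
Qed.

Lemma eq_components :
  [/\ forall j, (i_rho == i_u j) = false, forall j, (i_u j == i_rho) = false,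
      forall j, (i_theta == i_u j) = false, forall j, (i_u j == i_theta) = false &
      forall i j, (i_u i == i_u j) = (i == j)].
Proof.
by split=> i *; rewrite ?(eq_lrshift, eq_rlshift, eq_rshift, eq_lshift).
Qed.

Lemma sum_delta (R : pzSemiRingType) n (F : 'I_n -> R) i :
  \sum_j (i == j)%:R * F j = F i.
Proof.
rewrite (bigD1 i) //= eqxx mul1r big1 ?addr0 // => j /negbTE.
by rewrite eq_sym => ->; rewrite mul0r.
Qed.

(** The two sides of the momentum equation differ by exactly [r] times the normalized expression, so
    both vanish together. The energy equation is treated likewise with the factor [r * e]. *)
Lemma momentum_scaling (R : fieldType) (r p q n m k a b c d s1 s2 s3 : R) : r != 0 ->
  r * a + r * b + p * c + q * d = n * s2 + m * s1 + k * r * s3 <->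
  a + (b + p / r * c + q / r * d - m / r * s1 - n / r * s2 - k * s3) = 0.
Proof.
move=> r0; have E : r * (a + (b + p / r * c + q / r * d - m / r * s1 - n / r * s2
    - k * s3)) = r * a + r * b + p * c + q * d - (n * s2 + m * s1 + k * r * s3).
  by field.
split=> [H|H]; first by apply: (mulfI r0); rewrite E H subrr mulr0.
by apply/eqP; rewrite -subr_eq0 -E H mulr0.
Qed.

Lemma energy_scaling (R : fieldType) (r e q al a b c d : R) : r != 0 -> e != 0 ->
  r * e * a + r * e * b + q * c = al * d <->
  a + (b + q / (r * e) * c - al / (r * e) * d) = 0.
Proof.
move=> r0 e0; have E : r * e * (a + (b + q / (r * e) * c - al / (r * e) * d)) =
    r * e * a + r * e * b + q * c - al * d by field; rewrite r0 e0.
have re0 : r * e != 0 by rewrite mulf_neq0.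
split=> [H|H]; first by apply: (mulfI re0); rewrite E H subrr mulr0.
by apply/eqP; rewrite -subr_eq0 -E H mulr0.
Qed.

(** * Coefficient matrices of the system and their action *)

Section System.
Context {R : realType}.
Variables (rhob : R) (ub : 'rV[R]_3).
Variables thetab prho ptheta etheta k nu lambda alpha : R.

Definition first_order (j : 'I_3) : 'M[R]_5 :=
  (ub 0 j)%:M + rhob *: delta_mx i_rho (i_u j)
  + (prho / rhob) *: delta_mx (i_u j) i_rho
  + (ptheta / rhob) *: delta_mx (i_u j) i_theta
  + (thetab * ptheta / (rhob * etheta)) *: delta_mx i_theta (i_u j).

Definition graddiv_order (j l : 'I_3) : 'M[R]_5 :=
  (- ((nu + lambda) / rhob)) *: delta_mx (i_u j) (i_u l).

Definition laplacian_order : 'M[R]_5 :=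
  (- (nu / rhob)) *: (\sum_i delta_mx (i_u i) (i_u i))
  + (- (alpha / (rhob * etheta))) *: delta_mx i_theta i_theta.

Definition third_order (j : 'I_3) : 'M[R]_5 :=
  (- k) *: delta_mx (i_u j) i_rho.

(** Derivatives are listed in the order in which the equations compose them, for instance
    [[:: j; l; l]] for the gradient of a Laplacian. The lists [[:: j; l]] and [[:: l; j]] share a
    multi-index, and [coeffs] adds their matrices. *)
Definition nsfk_terms : seq (seq 'I_3 * 'M[R]_5) :=
  [seq ([:: j], first_order j) | j <- enum 'I_3]
  ++ [seq ([:: j; l], graddiv_order j l) | j <- enum 'I_3, l <- enum 'I_3]
  ++ [seq ([:: l; l], laplacian_order) | l <- enum 'I_3]
  ++ [seq ([:: j; l; l], third_order j) | j <- enum 'I_3, l <- enum 'I_3].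

Lemma size_nsfk_terms : {in nsfk_terms, forall p, size p.1 <= 3}%N.
Proof.
move=> p; rewrite !mem_cat.
by case/or4P => [/mapP[? _ ->]|/allpairsP[? [_ _ ->]]|/mapP[? _ ->]|
  /allpairsP[? [_ _ ->]]].
Qed.

Lemma big_nsfk_terms (W : nmodType) (F : seq 'I_3 * 'M[R]_5 -> W) :
  \sum_(p <- nsfk_terms) F p =
  \sum_j F ([:: j], first_order j)
  + (\sum_j \sum_l F ([:: j; l], graddiv_order j l)
  + (\sum_l F ([:: l; l], laplacian_order)
  + \sum_j \sum_l F ([:: j; l; l], third_order j))).
Proof.
by rewrite !big_cat /= !big_map !big_allpairs_dep !big_enum /=;
   congr (_ + (_ + (_ + _))); apply: eq_bigr => j _; rewrite big_enum.
Qed.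

Lemma first_order_mul j (v : 'cV[R]_5) :
  [/\ (first_order j *m v) i_rho 0 = ub 0 j * v i_rho 0 + rhob * v (i_u j) 0,
      forall i, (first_order j *m v) (i_u i) 0 =
        ub 0 j * v (i_u i) 0
        + (i == j)%:R * (prho / rhob * v i_rho 0 + ptheta / rhob * v i_theta 0) &
      (first_order j *m v) i_theta 0 = ub 0 j * v i_theta 0
        + thetab * ptheta / (rhob * etheta) * v (i_u j) 0].
Proof.
have [e1 e2 e3 e4 e5] := eq_components.
have E i : (first_order j *m v) i 0 = ub 0 j * v i 0
  + rhob * ((i == i_rho)%:R * v (i_u j) 0)
  + prho / rhob * ((i == i_u j)%:R * v i_rho 0)
  + ptheta / rhob * ((i == i_u j)%:R * v i_theta 0)
  + thetab * ptheta / (rhob * etheta) * ((i == i_theta)%:R * v (i_u j) 0).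
  rewrite !mulmxDl mul_scalar_mx -!scalemxAl.
  by rewrite mxE [X in X + _]mxE [X in X + _ + _]mxE [X in X + _ + _ + _]mxE;
     rewrite [X in X + _ + _ + _ + _]mxE
       ![(_ *: (delta_mx _ _ *m v)) i 0]mxE !delta_mul.
split=> [|i|]; rewrite E ?eqxx ?e1 ?e2 ?e3 ?e4 ?e5.
- by rewrite /=; ring.
- by rewrite /=; ring.
- by rewrite /=; ring.
Qed.

Lemma graddiv_order_mul j l (v : 'cV[R]_5) :
  [/\ (graddiv_order j l *m v) i_rho 0 = 0,
      forall i, (graddiv_order j l *m v) (i_u i) 0 =
        (i == j)%:R * (- ((nu + lambda) / rhob) * v (i_u l) 0) &
      (graddiv_order j l *m v) i_theta 0 = 0].
Proof.
have [e1 _ e3 _ e5] := eq_components.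
by split=> [|i|]; rewrite -scalemxAl mxE delta_mul ?e1 ?e3 ?e5 /=; ring.
Qed.

Lemma laplacian_order_mul (v : 'cV[R]_5) :
  [/\ (laplacian_order *m v) i_rho 0 = 0,
      forall i, (laplacian_order *m v) (i_u i) 0 = - (nu / rhob) * v (i_u i) 0 &
      (laplacian_order *m v) i_theta 0 =
        - (alpha / (rhob * etheta)) * v i_theta 0].
Proof.
have [_ _ e3 e4 e5] := eq_components.
have E i : (laplacian_order *m v) i 0 =
    - (nu / rhob) * (\sum_j (i == i_u j)%:R * v (i_u j) 0)
    - alpha / (rhob * etheta) * ((i == i_theta)%:R * v i_theta 0).
  rewrite mulmxDl -!scalemxAl mulmx_suml mxE [X in X + _]mxE [X in _ + X]mxE.
  rewrite delta_mul summxE !mulNr; congr (- (_ * _) - _).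
  by apply: eq_bigr => j _; rewrite delta_mul.
split=> [|i|]; rewrite E ?e4 ?eqxx /=.
- by rewrite big1 => [|j _]; [ring|rewrite mul0r].
- by under eq_bigr do rewrite e5; rewrite sum_delta /=; ring.
- by rewrite big1 => [|j _]; [ring|rewrite e3 mul0r].
Qed.

Lemma third_order_mul j (v : 'cV[R]_5) :
  [/\ (third_order j *m v) i_rho 0 = 0,
      forall i, (third_order j *m v) (i_u i) 0 =
        (i == j)%:R * (- k * v i_rho 0) &
      (third_order j *m v) i_theta 0 = 0].
Proof.
have [e1 _ e3 _ e5] := eq_components.
by split=> [|i|]; rewrite -scalemxAl mxE delta_mul ?e1 ?e3 ?e5 /=; ring.
Qed.

(** Leaving [W] arbitrary makes one computation serve three times: with derivatives of [U] it gives
    the normal form, and with the weights of odd or even order applied to a fixed vector it gives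
    the two symbols. *)
Lemma sum_nsfk_terms (W : seq 'I_3 -> 'cV[R]_5) :
  let Y := \sum_(p <- nsfk_terms) p.2 *m W p.1 in
  [/\ Y i_rho 0 = \sum_j ub 0 j * W [:: j] i_rho 0
        + rhob * \sum_j W [:: j] (i_u j) 0,
      forall i, Y (i_u i) 0 = \sum_j ub 0 j * W [:: j] (i_u i) 0
        + prho / rhob * W [:: i] i_rho 0 + ptheta / rhob * W [:: i] i_theta 0
        - (nu + lambda) / rhob * (\sum_l W [:: i; l] (i_u l) 0)
        - nu / rhob * (\sum_l W [:: l; l] (i_u i) 0)
        - k * (\sum_l W [:: i; l; l] i_rho 0) &
      Y i_theta 0 = \sum_j ub 0 j * W [:: j] i_theta 0
        + thetab * ptheta / (rhob * etheta) * (\sum_j W [:: j] (i_u j) 0)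
        - alpha / (rhob * etheta) * (\sum_l W [:: l; l] i_theta 0)].
Proof.
move=> Y.
have E i : Y i 0 = \sum_j (first_order j *m W [:: j]) i 0
  + (\sum_j \sum_l (graddiv_order j l *m W [:: j; l]) i 0
  + (\sum_l (laplacian_order *m W [:: l; l]) i 0
  + \sum_j \sum_l (third_order j *m W [:: j; l; l]) i 0)).
  by rewrite /Y summxE big_nsfk_terms.
split=> [|i|]; rewrite E.
- rewrite [X in _ + (X + _)]big1 => [|j _]; last first.
    by rewrite big1 // => l _; have [-> _ _] := graddiv_order_mul j l (W [:: j; l]).
  rewrite [X in _ + (_ + (X + _))]big1 => [|l _]; last first.
    by have [-> _ _] := laplacian_order_mul (W [:: l; l]).
  rewrite [X in _ + (_ + (_ + X))]big1 => [|j _]; last first.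
    by rewrite big1 // => l _; have [-> _ _] := third_order_mul j (W [:: j; l; l]).
  rewrite !addr0 mulr_sumr -big_split; apply: eq_bigr => j _.
  by have [-> _ _] := first_order_mul j (W [:: j]).
- have -> : \sum_j (first_order j *m W [:: j]) (i_u i) 0 =
      \sum_j ub 0 j * W [:: j] (i_u i) 0
      + (prho / rhob * W [:: i] i_rho 0 + ptheta / rhob * W [:: i] i_theta 0).
    (* The pressure contribution to row [i] is rewritten as a sum over [j] concentrated at [j = i],
       so that it can be matched term by term. The grad-div and capillary sums below use the same
       device. *)
    rewrite -[X in _ + X](sum_delta (fun j => prho / rhob * W [:: j] i_rho 0
      + ptheta / rhob * W [:: j] i_theta 0)) -big_split.
    by apply: eq_bigr => j _; have [_ -> _] := first_order_mul j (W [:: j]).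
  have -> : \sum_j \sum_l (graddiv_order j l *m W [:: j; l]) (i_u i) 0 =
      - ((nu + lambda) / rhob) * (\sum_l W [:: i; l] (i_u l) 0).
    rewrite mulr_sumr -(sum_delta (fun j => \sum_l _ * W [:: j; l] (i_u l) 0)).
    apply: eq_bigr => j _; rewrite mulr_sumr; apply: eq_bigr => l _.
    by have [_ -> _] := graddiv_order_mul j l (W [:: j; l]).
  have -> : \sum_l (laplacian_order *m W [:: l; l]) (i_u i) 0 =
      - (nu / rhob) * (\sum_l W [:: l; l] (i_u i) 0).
    rewrite mulr_sumr; apply: eq_bigr => l _.
    by have [_ -> _] := laplacian_order_mul (W [:: l; l]).
  have -> : \sum_j \sum_l (third_order j *m W [:: j; l; l]) (i_u i) 0 =
      - k * (\sum_l W [:: i; l; l] i_rho 0).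
    rewrite mulr_sumr -(sum_delta (fun j => \sum_l _ * W [:: j; l; l] i_rho 0)).
    apply: eq_bigr => j _; rewrite mulr_sumr; apply: eq_bigr => l _.
    by have [_ -> _] := third_order_mul j (W [:: j; l; l]).
  by rewrite !mulNr !addrA.
- rewrite [X in _ + (X + _)]big1 => [|j _]; last first.
    by rewrite big1 // => l _; have [_ _ ->] := graddiv_order_mul j l (W [:: j; l]).
  rewrite [X in _ + (_ + (_ + X))]big1 => [|j _]; last first.
    by rewrite big1 // => l _; have [_ _ ->] := third_order_mul j (W [:: j; l; l]).
  have -> : \sum_l (laplacian_order *m W [:: l; l]) i_theta 0 =
      - (alpha / (rhob * etheta)) * (\sum_l W [:: l; l] i_theta 0).
    rewrite mulr_sumr; apply: eq_bigr => l _.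
    by have [_ _ ->] := laplacian_order_mul (W [:: l; l]).
  rewrite add0r addr0 mulNr; congr (_ - _).
  rewrite mulr_sumr -big_split; apply: eq_bigr => j _.
  by have [_ _ ->] := first_order_mul j (W [:: j]).
Qed.

(** * Reduction of the system to normal form *)

Hypotheses (rhob_gt0 : 0 < rhob) (thetab_gt0 : 0 < thetab) (prho_gt0 : 0 < prho).
Hypotheses (etheta_gt0 : 0 < etheta) (k_gt0 : 0 < k).
Hypotheses (nu_gt0 : 0 < nu) (lambda_gt0 : 0 < lambda) (alpha_gt0 : 0 < alpha).

Let terms := nsfk_terms.
Let L : multiindex 3 3 -> 'M[R]_5 := coeffs terms.

Let terms_size : {in terms, forall p, size p.1 <= 3}%N := size_nsfk_terms.

(** The vector equation splits into its density, velocity and temperature rows. The density row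
    agrees as it stands; the others agree after division by [rhob] and [rhob * etheta]. *)
Lemma nsfk_normal_form : normal_form
  (nsfk_system rhob ub thetab prho ptheta etheta k nu lambda alpha) L.
Proof.
move=> U rU t x; rewrite (sum_coeffs_derive terms_size) //.
pose W s : 'cV[R]_5 := \col_i partials s (fun y => U t y i 0) x.
have := sum_nsfk_terms W.
rewrite -/terms; set Y := \sum_(p <- terms) _ => -[Yr Yu Yt].
have sU i : smooth (fun y => U t y i 0) by have [_] := rU i; apply.
have r0 : rhob != 0 by rewrite gt_eqF.
have e0 : etheta != 0 by rewrite gt_eqF.
have uE s i : (fun y => (\row_j U s y (i_u j) 0) 0 i : R) =
    fun y => U s y (i_u i) 0.
  by apply/funext => y; rewrite mxE.
have divE : divergence (fun y => \row_j U t y (i_u j) 0) =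
    fun y => \sum_l partial l (fun y => U t y (i_u l) 0) y.
  by apply/funext => y; apply: eq_bigr => l _; rewrite /= uE.
have WE s i : W s i 0 = partials s (fun y => U t y i 0) x by rewrite mxE.
have tdE i : time_derive U t x i 0 = derive1 (fun s => U s x i 0) t by rewrite mxE.
have zeroP : (time_derive U t x + Y = 0) <->
    [/\ time_derive U t x i_rho 0 + Y i_rho 0 = 0,
        forall i, time_derive U t x (i_u i) 0 + Y (i_u i) 0 = 0
      & time_derive U t x i_theta 0 + Y i_theta 0 = 0].
  have YE i : (time_derive U t x + Y) i 0 = time_derive U t x i 0 + Y i 0.
    by rewrite mxE.
  split=> [E|[Er Eu Et]]; first by split=> [|i|]; rewrite -YE E mxE.
  by apply/colP; apply: component_ind => [|j|]; rewrite YE [RHS]mxE.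
apply: iff_trans (iff_sym zeroP); rewrite /nsfk_system /= divE.
have -> : derive1 (fun s => U s x i_rho 0) t
    + advect ub (fun y => U t y i_rho 0) x
    + rhob * (\sum_l partial l (fun y => U t y (i_u l) 0) x)
    = time_derive U t x i_rho 0 + Y i_rho 0.
  rewrite Yr tdE addrA; congr (_ + _ + _ * _);
    by apply: eq_bigr => j _; rewrite WE.
set lhs : 'rV[R]_3 := (X in [/\ _, X = _ & _]).
set rhs : 'rV[R]_3 := (X in [/\ _, _ = X & _]).
have P2P : lhs = rhs <-> forall i, time_derive U t x (i_u i) 0 + Y (i_u i) 0 = 0.
  have P2i i : rhob * time_derive U t x (i_u i) 0
      + rhob * (\sum_j ub 0 j * W [:: j] (i_u i) 0)
      + prho * W [:: i] i_rho 0 + ptheta * W [:: i] i_theta 0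
      = nu * (\sum_l W [:: l; l] (i_u i) 0)
      + (nu + lambda) * (\sum_l W [:: i; l] (i_u l) 0)
      + k * rhob * (\sum_l W [:: i; l; l] i_rho 0) <->
      time_derive U t x (i_u i) 0 + Y (i_u i) 0 = 0.
    by rewrite Yu; exact: momentum_scaling.
  have mxD (A B : 'rV[R]_3) i : (A + B) 0 i = A 0 i + B 0 i by rewrite mxE.
  have mxZ c (A : 'rV[R]_3) i : (c *: A) 0 i = c * A 0 i by rewrite mxE.
  have lhsE i : lhs 0 i = rhob * time_derive U t x (i_u i) 0
      + rhob * (\sum_j ub 0 j * W [:: j] (i_u i) 0)
      + prho * W [:: i] i_rho 0 + ptheta * W [:: i] i_theta 0.
    rewrite /lhs !mxD !mxZ; congr (_ + _ + _ + _).
    - rewrite mxE tdE; apply: (congr1 (fun g : R -> R => rhob * derive1 g t)).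
      by apply/funext => s; rewrite mxE.
    - rewrite mxE /= uE; congr (_ * _).
      by apply: eq_bigr => j _; rewrite WE.
    - by rewrite mxE WE.
    - by rewrite mxE WE.
  have rhsE i : rhs 0 i = nu * (\sum_l W [:: l; l] (i_u i) 0)
      + (nu + lambda) * (\sum_l W [:: i; l] (i_u l) 0)
      + k * rhob * (\sum_l W [:: i; l; l] i_rho 0).
    rewrite /rhs !mxD !mxZ; congr (_ + _ + _).
    - rewrite mxE /= uE; congr (_ * _).
      by apply: eq_bigr => j _; rewrite WE.
    (* The outer derivative passes through the sum that defines the divergence, by smoothness of the
       summands; the Laplacian below is treated in the same way. *)
    - rewrite mxE partial_sum => [|l]; last by apply: smooth_partial.
      congr (_ * _).
      by apply: eq_bigr => j _; rewrite WE.
    - rewrite mxE partial_sum => [|l]; last by do 2 apply: smooth_partial.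
      congr (_ * _).
      by apply: eq_bigr => j _; rewrite WE.
  split=> [H i|H].
    by apply: (P2i i).1; rewrite -lhsE -rhsE H.
  by apply/rowP => i; rewrite lhsE rhsE; exact: (P2i i).2 (H i).
have P3P : rhob * etheta * derive1 (fun s => U s x i_theta 0) t
    + rhob * etheta * advect ub (fun y => U t y i_theta 0) x
    + thetab * ptheta * (\sum_l partial l (fun y => U t y (i_u l) 0) x)
    = alpha * laplacian (fun y => U t y i_theta 0) x <->
    time_derive U t x i_theta 0 + Y i_theta 0 = 0.
  rewrite Yt tdE.
  rewrite (_ : \sum_l partial l _ x = \sum_l W [:: l] (i_u l) 0); last first.
    by apply: eq_bigr => l _; rewrite WE.
  rewrite (_ : laplacian _ x = \sum_l W [:: l; l] i_theta 0); last first.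
    by apply: eq_bigr => l _; rewrite WE.
  rewrite (_ : advect _ _ x = \sum_j ub 0 j * W [:: j] i_theta 0); last first.
    by apply: eq_bigr => l _; rewrite WE.
  by apply: energy_scaling.
by split=> -[H1 /P2P H2 /P3P H3]; split; first [exact: H1|exact: H2|exact: H3].
Qed.

(** * The symmetrizer *)

(** The density entry times [rhob] is [prho / rhob + k * |xi|^2], and the temperature entry times
    [thetab * ptheta / (rhob * etheta)] is [ptheta / rhob]: these are the coupling coefficients of
    the velocity rows. The squared length is a plain sum of squares, so smoothness involves no
    square root. *)
Definition symmetrizer_diag (xi : 'rV[R]_3) : 'rV[R]_5 :=
  \row_i (if i == i_rho then (prho / rhob + k * \sum_j xi 0 j ^+ 2) / rhob
          else if i == i_theta then etheta / thetab else 1).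

Lemma symmetrizer_diagE xi :
  [/\ symmetrizer_diag xi 0 i_rho = (prho / rhob + k * \sum_j xi 0 j ^+ 2) / rhob,
      forall j, symmetrizer_diag xi 0 (i_u j) = 1 &
      symmetrizer_diag xi 0 i_theta = etheta / thetab].
Proof.
have [_ e2 _ e4 _] := eq_components.
by split=> [|j|]; rewrite mxE ?e2 ?e4 ?eqxx.
Qed.

Lemma symmetrizer_diag_gt0 xi i : 0 < symmetrizer_diag xi 0 i.
Proof.
have [Sr Su St] := symmetrizer_diagE xi.
move: i; apply: component_ind => [|j|]; rewrite ?Sr ?Su ?St ?divr_gt0 //.
rewrite ltr_wpDr ?divr_gt0 // mulr_ge0 ?(ltW k_gt0) // sumr_ge0 // => j _.
exact: sqr_ge0.
Qed.

Lemma smooth_symmetrizer i j (O : set 'rV[R]_3) :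
  smooth_on O (fun xi => diag_mx (symmetrizer_diag xi) i j).
Proof.
move=> n; apply: (@Ck_on_sub _ _ _ setT) => //.
case: (eqVneq i j) => [<-|ij]; last first.
  rewrite (_ : (fun _ => _) = fun=> 0); first exact: Ck_cst.
  by apply/funext => xi; rewrite mxE (negbTE ij).
rewrite (_ : (fun _ => _) = fun xi => symmetrizer_diag xi 0 i); last first.
  by apply/funext => xi; rewrite mxE eqxx.
move: i {j}; apply: component_ind => [|j|].
- rewrite (_ : (fun _ => _) =
    fun xi : 'rV[R]_3 => (prho / rhob + k * \sum_j xi 0 j * xi 0 j) * rhob^-1).
    apply: CkM; last exact: Ck_cst.
    apply: (@CkD _ _ _ (fun=> prho / rhob)); first exact: Ck_cst.
    apply: CkM; first exact: Ck_cst.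
    by apply: Ck_sum => l; apply: CkM; exact: Ck_coord.
  apply/funext => xi; have [-> _ _] := symmetrizer_diagE xi.
  by under eq_bigr do rewrite expr2.
- rewrite (_ : (fun _ => _) = fun=> 1); first exact: Ck_cst.
  by apply/funext => xi; have [_ -> _] := symmetrizer_diagE xi.
- rewrite (_ : (fun _ => _) = fun=> etheta / thetab); first exact: Ck_cst.
  by apply/funext => xi; have [_ _ ->] := symmetrizer_diagE xi.
Qed.

(** * The symbols at a fixed nonzero frequency *)

Section Frequency.
Variable xi : 'rV[R]_3.
Hypothesis xi_neq0 : xi != 0.
Let w := direction xi.
Let q := enorm xi.

(** Only orders one and three contribute. The capillary term has coefficient [- k] and symbol sign
    -1, so it adds [k * q ^+ 2] to the pressure coefficient once the squares of the unit direction
    are summed to 1. *)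
Lemma mul_symbolA (v : 'cV[R]_5) :
  [/\ (symbolA L xi *m v) i_rho 0 =
        (\sum_j ub 0 j * w 0 j) * v i_rho 0 + rhob * \sum_j w 0 j * v (i_u j) 0,
      forall i, (symbolA L xi *m v) (i_u i) 0 =
        (\sum_j ub 0 j * w 0 j) * v (i_u i) 0
        + w 0 i * ((prho / rhob + k * q ^+ 2) * v i_rho 0
                   + ptheta / rhob * v i_theta 0) &
      (symbolA L xi *m v) i_theta 0 =
        (\sum_j ub 0 j * w 0 j) * v i_theta 0
        + thetab * ptheta / (rhob * etheta) * \sum_j w 0 j * v (i_u j) 0].
Proof.
(* Setting [W] to zero on lists of even length lets the sum over all terms compute the odd part. *)
pose W (s : seq 'I_3) : 'cV[R]_5 := if odd (size s) then
  (q ^+ (size s).-1 * (-1) ^+ (size s).-1./2 * \prod_(i <- s) w 0 i) *: v else 0.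
have := sum_nsfk_terms W.
rewrite -/terms /= (_ : \sum_(p <- terms) _ = symbolA L xi *m v); last first.
  rewrite (symbolA_coeffs terms_size) mulmx_suml [RHS]big_mkcond.
  apply: eq_bigr => p _; rewrite /W; case: ifP => _; last by rewrite mulmx0.
  by rewrite -scalemxAl -scalemxAr.
have W1 j i : W [:: j] i 0 = w 0 j * v i 0.
  by rewrite /W /= mxE big_seq1 !expr0 !mul1r.
have W2 j l i : W [:: j; l] i 0 = 0 by rewrite /W /= mxE.
have W3 j l i : W [:: j; l; l] i 0 = - q ^+ 2 * w 0 j * v i 0 * w 0 l ^+ 2.
  by rewrite /W /= mxE !big_cons big_nil expr1; ring.
move=> [-> Yu ->]; split=> [|i|]; rewrite ?Yu; move=> {Yu}.
- rewrite mulr_suml; congr (_ + _ * _);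
    by apply: eq_bigr => j _; rewrite W1 ?mulrA.
- rewrite !W1 (eq_bigr _ (fun l _ => W2 i l (i_u l))) big1_eq.
  rewrite (eq_bigr _ (fun l _ => W2 l l (i_u i))) big1_eq.
  under [X in k * X]eq_bigr do rewrite W3.
  rewrite -mulr_sumr (sum_direction_sqr xi_neq0).
  rewrite (_ : \sum_j _ = (\sum_j ub 0 j * w 0 j) * v (i_u i) 0); last first.
    by rewrite mulr_suml; apply: eq_bigr => j _; rewrite W1 mulrA.
  by ring.
- rewrite [X in _ - _ * X]big1 => [|l _]; last exact: W2.
  rewrite mulr0 subr0 mulr_suml; congr (_ + _ * _);
    by apply: eq_bigr => j _; rewrite W1 ?mulrA.
Qed.

(** Only order two contributes: the symbol sign -1 cancels the minus signs of the diffusive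
    coefficients. *)
Lemma mul_symbolB (v : 'cV[R]_5) :
  [/\ (symbolB L xi *m v) i_rho 0 = 0,
      forall i, (symbolB L xi *m v) (i_u i) 0 = q ^+ 2 *
        (nu / rhob * v (i_u i) 0
         + (nu + lambda) / rhob * w 0 i * \sum_j w 0 j * v (i_u j) 0) &
      (symbolB L xi *m v) i_theta 0 =
        q ^+ 2 * (alpha / (rhob * etheta)) * v i_theta 0].
Proof.
pose W (s : seq 'I_3) : 'cV[R]_5 := if ~~ odd (size s) then
  (q ^+ size s * (-1) ^+ (size s)./2 * \prod_(i <- s) w 0 i) *: v else 0.
have := sum_nsfk_terms W.
rewrite -/terms /= (_ : \sum_(p <- terms) _ = symbolB L xi *m v); last first.
  rewrite (symbolB_coeffs terms_size) mulmx_suml [RHS]big_mkcond.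
  apply: eq_bigr => p _; rewrite /W; case: ifP => _; last by rewrite mulmx0.
  by rewrite -scalemxAl -scalemxAr.
have W1 j i : W [:: j] i 0 = 0 by rewrite /W /= mxE.
have W2 j l i : W [:: j; l] i 0 = - q ^+ 2 * w 0 j * (w 0 l * v i 0).
  by rewrite /W /= mxE !big_cons big_nil expr1; ring.
have W3 j l i : W [:: j; l; l] i 0 = 0 by rewrite /W /= mxE.
have S2 i : \sum_l W [:: l; l] i 0 = - q ^+ 2 * v i 0.
  transitivity (\sum_l - q ^+ 2 * v i 0 * w 0 l ^+ 2).
    by apply: eq_bigr => l _; rewrite W2; ring.
  by rewrite -mulr_sumr (sum_direction_sqr xi_neq0) mulr1.
have S1 i (c : 'I_3 -> R) : \sum_j c j * W [:: j] i 0 = 0.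
  by rewrite big1 // => j _; rewrite W1 mulr0.
have S0 : \sum_j W [:: j] (i_u j) 0 = 0 by rewrite big1.
move=> [-> Yu ->]; split=> [|i|]; rewrite ?Yu; move=> {Yu}.
- by rewrite S1 S0; ring.
- rewrite S1 !W1 S2 big1_eq.
  by rewrite (eq_bigr _ (fun l _ => W2 i l (i_u l))) -mulr_sumr; ring.
- by rewrite S1 S0 S2; ring.
Qed.

Let S := diag_mx (symmetrizer_diag xi).
Let dot (v : 'cV[R]_5) := \sum_j w 0 j * v (i_u j) 0.

(** The advective part is a multiple of the form of [S], and each coupling pairs with its mirror
    image under the same coefficient. The result is visibly unchanged when [v] and [v'] are
    exchanged. *)
Lemma symmetrizer_symbolA_form (v v' : 'cV[R]_5) :
  (v'^T *m (S *m symbolA L xi) *m v) 0 0 =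
  (\sum_j ub 0 j * w 0 j) *
    ((prho / rhob + k * q ^+ 2) / rhob * (v' i_rho 0 * v i_rho 0)
     + \sum_j v' (i_u j) 0 * v (i_u j) 0
     + etheta / thetab * (v' i_theta 0 * v i_theta 0))
  + (prho / rhob + k * q ^+ 2) * (v' i_rho 0 * dot v + v i_rho 0 * dot v')
  + ptheta / rhob * (v' i_theta 0 * dot v + v i_theta 0 * dot v').
Proof.
rewrite mul_diag_form sum_components.
have [-> Su ->] := symmetrizer_diagE xi.
have [-> Au ->] := mul_symbolA v.
rewrite -enorm_sqr -/q -/(dot v); set a := \sum_j ub 0 j * w 0 j.
set X := (prho / rhob + k * q ^+ 2) * v i_rho 0 + ptheta / rhob * v i_theta 0.
have -> : \sum_j v' (i_u j) 0 * symmetrizer_diag xi 0 (i_u j)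
      * (symbolA L xi *m v) (i_u j) 0 =
    a * (\sum_j v' (i_u j) 0 * v (i_u j) 0) + X * dot v'.
  rewrite !mulr_sumr -big_split; apply: eq_bigr => j _.
  by rewrite Su Au -/a -/X /=; ring.
rewrite /X; field.
by rewrite !gt_eqF.
Qed.

Lemma symmetrizer_symbolB_form (v v' : 'cV[R]_5) :
  (v'^T *m (S *m symbolB L xi) *m v) 0 0 =
  q ^+ 2 * (nu / rhob * (\sum_j v' (i_u j) 0 * v (i_u j) 0)
            + (nu + lambda) / rhob * (dot v' * dot v)
            + alpha / (rhob * thetab) * (v' i_theta 0 * v i_theta 0)).
Proof.
rewrite mul_diag_form sum_components.
have [-> Su ->] := symmetrizer_diagE xi.
have [-> Bu ->] := mul_symbolB v; rewrite mulr0 add0r -/(dot v).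
have -> : \sum_j v' (i_u j) 0 * symmetrizer_diag xi 0 (i_u j)
      * (symbolB L xi *m v) (i_u j) 0 =
    q ^+ 2 * (nu / rhob) * (\sum_j v' (i_u j) 0 * v (i_u j) 0)
    + q ^+ 2 * ((nu + lambda) / rhob) * dot v * dot v'.
  move: Bu; rewrite -/(dot v); move: (dot v) => c Bu.
  rewrite !mulr_sumr -big_split; apply: eq_bigr => j _.
  by rewrite Su Bu /=; ring.
field.
by rewrite !gt_eqF.
Qed.

(** On the diagonal the grad-div part is a nonnegative multiple of [dot v ^+ 2] and is dropped. *)
Lemma symbolB_form_ge (v : 'cV[R]_5) :
  q ^+ 2 * (nu / rhob * (\sum_j v (i_u j) 0 ^+ 2)
            + alpha / (rhob * thetab) * v i_theta 0 ^+ 2)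
  <= (v^T *m (S *m symbolB L xi) *m v) 0 0.
Proof.
rewrite symmetrizer_symbolB_form ler_wpM2l ?sqr_ge0 // addrAC -!expr2 lerDl.
by rewrite mulr_ge0 ?sqr_ge0 // divr_ge0 ?addr_ge0 ?ltW.
Qed.

Lemma symbolB_form_ge0 (v : 'cV[R]_5) :
  0 <= (v^T *m (S *m symbolB L xi) *m v) 0 0.
Proof.
apply: le_trans (symbolB_form_ge v).
have sum_ge0 : 0 <= \sum_j v (i_u j) 0 ^+ 2.
  by rewrite sumr_ge0 // => j _; exact: sqr_ge0.
by rewrite mulr_ge0 ?sqr_ge0 // addr_ge0 // mulr_ge0 ?sqr_ge0 // ltW //
   divr_gt0 // mulr_gt0.
Qed.

(** On the kernel the form of [S *m symbolB L xi] vanishes, so its lower bound, a sum of squares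
    with positive weights, vanishes term by term. *)
Lemma ker_symbolB (v : 'cV[R]_5) : symbolB L xi *m v = 0 ->
  (forall j, v (i_u j) 0 = 0) /\ v i_theta 0 = 0.
Proof.
move=> Bv; have := symbolB_form_ge v.
have -> : (v^T *m (S *m symbolB L xi) *m v) 0 0 = 0.
  by rewrite -!mulmxA Bv !mulmx0 mxE.
have q2 : 0 < q ^+ 2 by rewrite exprn_gt0 // enorm_gt0.
have c1 : 0 < nu / rhob by rewrite divr_gt0.
have c2 : 0 < alpha / (rhob * thetab) by rewrite divr_gt0 ?mulr_gt0.
have sum_ge0 : 0 <= \sum_j v (i_u j) 0 ^+ 2.
  by rewrite sumr_ge0 // => j _; exact: sqr_ge0.
rewrite pmulr_rle0 // => le0.
have t1 : 0 <= nu / rhob * \sum_j v (i_u j) 0 ^+ 2 by rewrite mulr_ge0 ?(ltW c1).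
have t2 : 0 <= alpha / (rhob * thetab) * v i_theta 0 ^+ 2.
  by rewrite mulr_ge0 ?sqr_ge0 ?(ltW c2).
move: (le_anti (introT andP (conj le0 (addr_ge0 t1 t2)))) => /eqP.
rewrite paddr_eq0 // mulf_eq0 (gt_eqF c1)
  [X in _ && X]mulf_eq0 (gt_eqF c2) /= sqrf_eq0.
move=> /andP[+ /eqP v0].
rewrite psumr_eq0 => [/allP v0'|j _]; last exact: sqr_ge0.
split=> // j; apply/eqP; rewrite -sqrf_eq0; exact: v0' (mem_index_enum j).
Qed.

End Frequency.

(** * Symmetrizability and genuine coupling *)

Lemma nsfk_symmetrizable : symbol_symmetrizable L.
Proof.
have innerC (v v' : 'cV[R]_5) :
    \sum_j v (i_u j) 0 * v' (i_u j) 0 = \sum_j v' (i_u j) 0 * v (i_u j) 0.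
  by apply: eq_bigr => j _; rewrite mulrC.
exists (fun xi => diag_mx (symmetrizer_diag xi)); split=> [i j|xi xi0].
  exact: smooth_symmetrizer.
split.
- split=> [|v v0]; first exact: tr_diag_mx.
  (* The factor 1 brings the form of [S] into the shape of [mul_diag_form]. It becomes a sum of
     nonnegative terms, and a nonzero coordinate of [v] gives a nonzero one. *)
  rewrite -[diag_mx _]mulmx1 mul_diag_form.
  have [i vi0] : exists i, v i 0 != 0.
    by apply/existsP; apply: contraNT v0 => /existsPn v0; apply/eqP/colP => i;
       rewrite mxE; apply/eqP; rewrite -[_ == _]negbK.
  have pos j : 0 <= v j 0 * symmetrizer_diag xi 0 j * (1%:M *m v) j 0.
    by rewrite mul1mx mulrAC -expr2 mulr_ge0 ?sqr_ge0 ?ltW ?symmetrizer_diag_gt0.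
  rewrite lt_def sumr_ge0 ?andbT // psumr_eq0 //; apply/allPn.
  exists i; first exact: mem_index_enum.
  by rewrite mul1mx !mulf_neq0 // gt_eqF // symmetrizer_diag_gt0.
- apply: bilinear_symmetric => v v'; rewrite !symmetrizer_symbolA_form //.
  by rewrite (innerC v v'); ring.
- apply: bilinear_symmetric => v v'; rewrite !symmetrizer_symbolB_form //.
  by rewrite (innerC v v'); ring.
- by move=> v; exact: symbolB_form_ge0.
Qed.

Lemma nsfk_genuinely_coupled : genuinely_coupled L.
Proof.
move=> xi xi0 mu psi Bpsi; have [psiu psit] := ker_symbolB xi0 Bpsi.
apply: contraNneq => Apsi.
suff psir : psi i_rho 0 = 0.
  by apply/eqP/colP; apply: component_ind => [|j|]; rewrite [RHS]mxE.
have [_ Au _] := mul_symbolA xi0 psi.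
(* In the velocity rows [mu] and the advection multiply zero velocities, so only the density
   coupling remains. *)
have w0 i : direction xi 0 i * (prho / rhob + k * enorm xi ^+ 2) * psi i_rho 0 = 0.
  have : ((mu%:M + symbolA L xi) *m psi) (i_u i) 0 = 0 by rewrite Apsi mxE.
  rewrite mulmxDl mul_scalar_mx mxE [X in X + _]mxE Au psiu psit => <-; ring.
apply/eqP; apply: contraTT isT => r0.
have c0 : prho / rhob + k * enorm xi ^+ 2 != 0.
  by rewrite gt_eqF // ltr_wpDr ?divr_gt0 // mulr_ge0 ?sqr_ge0 ?ltW.
(* A nonzero density would force every coordinate of the direction to vanish, against its unit
   length. *)
have wz i : direction xi 0 i = 0.
  by apply: (mulIf c0); apply: (mulIf r0); rewrite w0 !mul0r.
have := sum_direction_sqr xi0; rewrite big1 => [/esym/eqP|i _].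
  by rewrite oner_eq0.
by rewrite wz expr0n.
Qed.
End System.

Theorem proposition5p8 (R : realType)
    (rhob : R) (ub : 'rV[R]_3) (thetab prho ptheta etheta k nu lambda alpha : R)
    (hrho : 0 < rhob) (htheta : 0 < thetab)
    (hprho : 0 < prho) (hptheta : 0 < ptheta) (hetheta : 0 < etheta)
    (hk : 0 < k) (hnu : 0 < nu) (hlambda : 0 < lambda) (halpha : 0 < alpha) :
  exists L : multiindex 3 3 -> 'M[R]_5,
    [/\ normal_form
          (nsfk_system rhob ub thetab prho ptheta etheta k nu lambda alpha) L,
        symbol_symmetrizable L
      & genuinely_coupled L].
Proof.
exists (coeffs (nsfk_terms rhob ub thetab prho ptheta etheta k nu lambda alpha)).
split.
- exact: nsfk_normal_form.
- exact: nsfk_symmetrizable.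
- exact: nsfk_genuinely_coupled.
Qed.
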